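(* Let $n\ge 1$, let $\sigma\in\mathscr{S}_n$, and let $\alpha=(\alpha_1,\ldots,\alpha_n)$ be a weak composition with $\alpha_i>\alpha_{i+1}$ for some $i\in\{1,\ldots,n-1\}$. Then $$E_{\alpha}^{\sigma}(\mathbf{x};q,t)=E_{s_i\alpha}^{\sigma s_i}(\mathbf{x};q,t)+c_{i,\alpha,\sigma}(q,t)\,E_{s_i\alpha}^{\sigma}(\mathbf{x};q,t),$$ where $$c_{i,\alpha,\sigma}(q,t)=t^{\mathrm{twinv}(s_i\alpha,\sigma)-\mathrm{twinv}(\alpha,\sigma)}\,\frac{1-t}{1-q^{\mathrm{leg}(u)+1}t^{\mathrm{arm}(u)}}\times\begin{cases}1 & \text{if }\sigma_i>\sigma_{i+1},\\ q^{\mathrm{leg}(u)+1}t^{\mathrm{arm}(u)} & \text{if }\sigma_i<\sigma_{i+1},\end{cases}$$ in which $u=(i+1,\alpha_{i+1}+1)\in\mathrm{dg}(s_i\alpha)$ (with $\mathrm{leg}(u)$ and $\mathrm{arm}(u)$ computed in the diagram of $s_i\alpha$), and $$\mathrm{twinv}(\alpha,\sigma)=|\{(k,l): k<l,\ \alpha_k\ge\alpha_l,\ \sigma_k<\sigma_l\}|.$$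
   Context: Fix $n$, write $[k]=\{1,\ldots,k\}$, and let $\mathbf{x}=(x_1,\ldots,x_n)$; polynomials lie in $\mathbb{Q}(q,t)[x_1,\ldots,x_n]$. A (weak) composition is a sequence $\alpha=(\alpha_1,\ldots,\alpha_n)$ of $n$ nonnegative integers. Permutations $\sigma\in\mathscr{S}_n$ are written in one-line notation $[\sigma_1,\ldots,\sigma_n]$; $s_i$ is the simple transposition exchanging $i$ and $i+1$; $s_i\alpha$ is $\alpha$ with the parts $\alpha_i,\alpha_{i+1}$ swapped; and $\sigma s_i=[\sigma_1,\ldots,\sigma_{i+1},\sigma_i,\ldots,\sigma_n]$ (the entries in positions $i$ and $i+1$ are swapped). Diagrams. $\mathrm{dg}(\alpha)=\{(i,r): i\in[n],\ r\in[\alpha_i]\}$, where $(i,r)$ is the box in column $i$ and row $r$. The augmented diagram is $\widehat{\mathrm{dg}}(\alpha)=\mathrm{dg}(\alpha)\cup\{(i,0): i\in[n]\}$; row $0$ is called the basement. For $u=(i,r)\in\mathrm{dg}(\alpha)$: $d(u)=(i,r-1)$; $\mathrm{leg}(u)=\alpha_i-r$; $$\mathrm{Arm}(u)=\{(j,r-1)\in\widehat{\mathrm{dg}}(\alpha): j<i,\ \alpha_j<\alpha_i\}\cup\{(j,r)\in\mathrm{dg}(\alpha): j>i,\ \alpha_j\le\alpha_i\};$$ and $\mathrm{arm}(u)=|\mathrm{Arm}(u)|$. Fillings. An augmented filling of shape $\alpha$ and basement $\sigma$ is a map $T:\widehat{\mathrm{dg}}(\alpha)\to[n]$ with $T(i,0)=\sigma_i$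 for all $i\in[n]$. A box $u=(i_u,r_u)$ attacks a box $v=(i_v,r_v)$ (boxes of $\widehat{\mathrm{dg}}(\alpha)$) if either $r_u=r_v$ and $i_u<i_v$, or $r_v=r_u-1$ and $i_v<i_u$. $T$ is non-attacking if $T(u)\ne T(v)$ whenever $u$ attacks $v$. $\mathrm{NAF}(\alpha,\sigma)$ is the set of non-attacking augmented fillings of shape $\alpha$ and basement $\sigma$. Statistics. $\mathbf{x}^T=\prod_{u\in\mathrm{dg}(\alpha)}x_{T(u)}$. $\mathrm{Des}(T)=\{u\in\mathrm{dg}(\alpha): T(u)>T(d(u))\}$ and $\mathrm{maj}(T)=\sum_{u\in\mathrm{Des}(T)}(\mathrm{leg}(u)+1)$. For $a,b\in[n]$ let $\chi_{a,b}=1$ if $a>b$ and $0$ otherwise, and let $\chi_{a,b,c}=\chi_{a,b}+\chi_{b,c}-\chi_{a,c}\in\{0,1\}$. A triple is $(u,v,w)$ with $u\in\mathrm{dg}(\alpha)$, $v\in\mathrm{Arm}(u)$, $w=d(u)$. $\mathrm{coinv}(T)$ is the number of triples with $\chi_{T(u),T(v),T(w)}=0$. The permuted-basement Macdonald polynomial is $$E_\alpha^\sigma(\mathbf{x};q,t)=\sum_{T\in\mathrm{NAF}(\alpha,\sigma)}\mathbf{x}^Tq^{\mathrm{maj}(T)}t^{\mathrm{coinv}(T)}\prod_{\substack{u\in\mathrm{dg}(\alpha)\\ T(u)\ne T(d(u))}}\frac{1-t}{1-q^{1+\mathrm{leg}(u)}t^{1+\mathrm{arm}(u)}}.$$ 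*)

(* Defs.v *)
From mathcomp Require Import all_boot all_order all_fingroup all_algebra.
From mathcomp Require Export mpoly.

Set Implicit Arguments.
Unset Strict Implicit.
Unset Printing Implicit Defensive.

Import GRing.Theory.
Local Open Scope ring_scope.

(* Columns, entries and variables are indexed by 'I_n = {0, ..., n-1} instead
   of {1, ..., n}; rows keep their usual numbering, row 0 being the basement. *)

Definition Qqt : fieldType := {fraction {mpoly rat[2]}}.

Definition q : Qqt := tofrac 'X_(Ordinal (isT : (0 < 2)%N)).
Definition t : Qqt := tofrac 'X_(Ordinal (isT : (1 < 2)%N)).

Definition composition (n : nat) : Type := {ffun 'I_n -> nat}.

Definition swap_parts n (i j : 'I_n) (alpha : composition n) : composition n :=
  [ffun k => alpha (tperm i j k)].

(* The product of permutations is (s * s') k = s' (s k), so this is the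
   permutation k |-> sigma (tperm i j k), whose one-line notation is that of
   sigma with the entries in positions i and j exchanged. *)
Definition swap_positions n (i j : 'I_n) (sigma : 'S_n) : 'S_n :=
  (tperm i j * sigma)%g.

Section Diagrams.
Context {n : nat}.
Implicit Types (alpha : composition n) (sigma : 'S_n).

(* The augmented diagram: pairs (i, r) with 0 <= r <= alpha i. *)
Definition box alpha : finType := {i : 'I_n & 'I_(alpha i).+1}.

Definition col alpha (u : box alpha) : 'I_n := tag u.
Definition row alpha (u : box alpha) : nat := tagged u.

(* The box in column i and row r; meaningful only when r <= alpha i, see
   [row_mkbox] (otherwise [inord] gives row 0). *)
Definition mkbox alpha (i : 'I_n) (r : nat) : box alpha :=
  Tagged (fun k => 'I_(alpha k).+1) (inord r : 'I_(alpha i).+1).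

Lemma col_mkbox alpha i r : col (mkbox alpha i r) = i.
Proof. by []. Qed.

Lemma row_mkbox alpha i r : (r <= alpha i)%N -> row (mkbox alpha i r) = r.
Proof. by move=> le_r; rewrite /row /mkbox /= inordK. Qed.

Definition dg alpha : {set box alpha} := [set u | 0 < row u]%N.

Definition down alpha (u : box alpha) : box alpha :=
  mkbox alpha (col u) (row u).-1.

Lemma row_down alpha (u : box alpha) : row (down u) = (row u).-1.
Proof.
rewrite row_mkbox //; apply: leq_trans (leq_pred _) _.
by rewrite -ltnS; apply: ltn_ord.
Qed.

Definition leg alpha (u : box alpha) : nat := (alpha (col u) - row u)%N.

(* Only used for u \in dg alpha, where the predecessor is not truncated. *)
Definition Arm alpha (u : box alpha) : {set box alpha} :=
  [set v | [&& row v == (row u).-1, (col v < col u)%N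
             & (alpha (col v) < alpha (col u))%N]]
  :|: [set v in dg alpha | [&& row v == row u, (col u < col v)%N
             & (alpha (col v) <= alpha (col u))%N]].

Definition arm alpha (u : box alpha) : nat := #|Arm u|.

Definition attacks alpha (u v : box alpha) : bool :=
  ((row u == row v) && (col u < col v)%N)
  || ((row u == (row v).+1) && (col v < col u)%N).

Definition filling alpha : finType := {ffun box alpha -> 'I_n}.

Definition has_basement alpha sigma (T : filling alpha) : bool :=
  [forall i, T (mkbox alpha i 0) == sigma i].

Definition non_attacking alpha (T : filling alpha) : bool :=
  [forall u, forall v, attacks u v ==> (T u != T v)].

Definition NAF alpha sigma : {set filling alpha} :=
  [set T | has_basement sigma T && non_attacking T].

Definition Des alpha (T : filling alpha) : {set box alpha} :=
  [set u in dg alpha | (T (down u) < T u)%N].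

Definition maj alpha (T : filling alpha) : nat :=
  \sum_(u in Des T) (leg u + 1)%N.

Definition chi (a b : 'I_n) : nat := (b < a)%N.

(* The subtraction is never truncated: a > c implies a > b or b > c. *)
Definition chi3 (a b c : 'I_n) : nat := (chi a b + chi b c - chi a c)%N.

(* The third box of a triple is determined by the first one: w = down u. *)
Definition triples alpha : {set box alpha * box alpha} :=
  [set uv | (uv.1 \in dg alpha) && (uv.2 \in Arm uv.1)].

Definition coinv alpha (T : filling alpha) : nat :=
  #|[set uv in triples alpha | chi3 (T uv.1) (T uv.2) (T (down uv.1)) == 0%N]|.

Definition monomial alpha (T : filling alpha) : {mpoly Qqt[n]} :=
  \prod_(u in dg alpha) 'X_(T u).

Definition weight alpha (T : filling alpha) : Qqt :=
  q ^+ maj T * t ^+ coinv T *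
  \prod_(u in dg alpha | T u != T (down u))
    ((1 - t) / (1 - q ^+ (1 + leg u) * t ^+ (1 + arm u))).

Definition macdonald alpha sigma : {mpoly Qqt[n]} :=
  \sum_(T in NAF alpha sigma) weight T *: monomial T.

Definition twinv alpha sigma : nat :=
  #|[set kl : 'I_n * 'I_n | [&& (kl.1 < kl.2)%N,
       (alpha kl.2 <= alpha kl.1)%N & (sigma kl.1 < sigma kl.2)%N]]|.

(* The two indices i, j stand for i, i+1. The exponent of t is an integer
   that may be negative. *)
Definition swap_coef (i j : 'I_n) alpha sigma : Qqt :=
  let salpha := swap_parts i j alpha in
  let u : box salpha := mkbox salpha j (alpha j).+1 in
  let z : Qqt := q ^+ (leg u + 1) * t ^+ arm u in
  t ^ ((twinv salpha sigma)%:Z - (twinv alpha sigma)%:Z)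
  * ((1 - t) / (1 - z))
  * (if (sigma j < sigma i)%N then 1 else z).

Lemma swap_coef_box_in_dg (i j : 'I_n) alpha :
  (alpha j < alpha i)%N ->
  let u := mkbox (swap_parts i j alpha) j (alpha j).+1 in
  row u = (alpha j).+1 /\ u \in dg (swap_parts i j alpha).
Proof.
move=> lt_ji u; have row_u : row u = (alpha j).+1.
  by rewrite row_mkbox // ffunE tpermR.
by rewrite inE row_u.
Qed.

End Diagrams.

(* Main.v *)
Require Import Defs.
From mathcomp Require Import all_boot all_order all_fingroup all_algebra.
From mathcomp Require Import zify ring.
Set Implicit Arguments.
Unset Strict Implicit.
Unset Printing Implicit Defensive.
Import GRing.Theory.
Local Open Scope ring_scope.

(** A filling is the sequence of its rows, and its weight is a product over
    pairs of consecutive rows; so a Macdonald polynomial is an iterated sum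
    over row words, [transfer] (see [macdonald_transfer]).  From this point of
    view, exchanging the parts of alpha in columns i and j = i + 1 amounts to
    keeping alpha and letting the tall column i and the short column j trade
    places in the left-to-right order of the columns ([transfer_relabel]).
    The three polynomials of the theorem become sums over the same row words,
    for the column orders [id] and [s = tperm i j].

    Let G_id and G_s be the generating functions of what lies above row h, as
    functions of the entries p and r of the tall and of the short column in
    row h.  The theorem is the case h = 0 of the relation
      G_id (p, r) = G_s (p, r) + c (p, r) G_s (r, p),
    which is proved for all h <= alpha j by descending induction on h
    ([transfer_exchange]).  Above the short column both orders give the same
    weights ([step_weight_above]); at its top and below, the induction comes
    down to an identity between the weights of single steps
    ([step_exchange_top], [step_exchange]).

    Such an identity involves only the columns i and j.  A third column l
    meets them in attacks, which treat the two alike, and in triples.  The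
    coinversions of the latter are sums of chi's; by chi a b + chi b a = 1 the
    exponent of t contributed by l, together with the contribution [drift] of
    l to the exponent of t in c, is the same for all terms of the identity, up
    to powers of t that go with the descents of the columns i and j
    ([drift_side_excess_below], [drift_side_excess_above]).  So all third
    columns factor out ([step_weight_split], [environment_below],
    [environment_above]), and what is left is an identity of rational
    functions for each relative order of the two old and the two new entries
    ([pair_exchange], [top_exchange]).

    One coefficient c serves all rows because the parameters q^(leg + 1)
    t^(arm + 1) of the tall and the short box of a row have a ratio that does
    not depend on the row ([factorM]).  At the basement the accumulated drift
    is, up to the pair (i, j) itself, the difference of the two values of
    twinv ([twinv_swap]). *)

(** * Splitting off two indices *)

Section PairSplit.
Context {R : Type} {idx : R} {op : Monoid.com_law idx} {I : finType}.

Lemma big_outside_pair (i j : I) (D : I -> R) : i != j ->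
  \big[op/idx]_k D k =
  op (op (D i) (D j)) (\big[op/idx]_(k | (k != i) && (k != j)) D k).
Proof.
move=> ij; rewrite (bigD1 i) //= (bigD1 j) //=; last by rewrite eq_sym.
by rewrite Monoid.mulmA.
Qed.

Lemma big2_outside_pair (i j : I) (D : I -> I -> R) : i != j ->
  \big[op/idx]_k \big[op/idx]_l D k l =
  op (op (op (D i i) (D i j)) (op (D j i) (D j j)))
     (op (\big[op/idx]_(l | (l != i) && (l != j))
             op (op (D i l) (D j l)) (op (D l i) (D l j)))
         (\big[op/idx]_(k | (k != i) && (k != j))
            \big[op/idx]_(l | (l != i) && (l != j)) D k l)).
Proof.
move=> ij; rewrite (big_outside_pair _ ij).
under [X in op _ X]eq_bigr do rewrite (big_outside_pair _ ij).
rewrite !(big_outside_pair _ ij) !big_split /=.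
by rewrite [LHS](AC (((2*1)*(2*1))*(2*1)) (((1*2)*(4*5))*(((3*6)*(7*8))*9))).
Qed.
End PairSplit.

(** * Row-by-row weights *)

Definition word n : Type := {ffun 'I_n -> 'I_n}.

Definition swap_word n (i j : 'I_n) (e : word n) : word n :=
  [ffun k => e (tperm i j k)].

Section Transfer.
Context {F : fieldType} (q t : F) {n : nat}.
Implicit Types (pos : 'I_n -> 'I_n) (alpha : composition n) (h : nat).
Implicit Types (e f : word n) (k l : 'I_n).

(** Whether column [l] contributes a box to the arm of the box of column [k] in
    row [h.+1], the columns being placed from left to right by [pos]. *)
Definition in_arm pos alpha h k l : bool :=
  [&& (pos l < pos k)%N, (alpha l < alpha k)%N & (h <= alpha l)%N]
  || [&& (pos k < pos l)%N, (alpha l <= alpha k)%N & (h < alpha l)%N].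

Definition arm_size pos alpha h k : nat := (\sum_l in_arm pos alpha h k l)%N.

(** The non-attacking conditions between the new entry of column [k] and column
    [l], when the rows [h] and [h.+1] read [e] and [f]. *)
Definition compatible pos alpha h e f k l : bool :=
  ([&& h < alpha k, h < alpha l & k != l]%N ==> (f k != f l))
  && ([&& h < alpha k, h <= alpha l & pos l < pos k]%N ==> (f k != e l)).

Definition coinv_triple (a b c : 'I_n) : nat := (chi3 a b c == 0%N).

Definition step_coinv pos alpha h e f k l : nat :=
  if (h < alpha k)%N && in_arm pos alpha h k l
  then coinv_triple (f k) (if (pos l < pos k)%N then e l else f l) (e k)
  else 0%N.

(** Attacks are recorded as a factor 0 rather than in the range of summation, so
    that the weight of a step is a plain product over pairs of columns. *)
Definition pair_weight pos alpha h e f k l : F :=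
  (compatible pos alpha h e f k l)%:R * t ^+ step_coinv pos alpha h e f k l.

(** The weight of an entry [d] sitting on an entry [c]: [z] is the parameter of
    the denominator, [x] the weight of a descent. *)
Definition move_weight (z x : F) (c d : 'I_n) : F :=
  if d == c then 1 else (1 - t) / (1 - z) * x ^+ chi d c.

Definition box_weight pos alpha h e f k : F :=
  if (h < alpha k)%N
  then move_weight (q ^+ (alpha k - h) * t ^+ (arm_size pos alpha h k).+1)
         (q ^+ (alpha k - h)) (e k) (f k)
  else 1.

Definition step_weight pos alpha h e f : F :=
  (\prod_k box_weight pos alpha h e f k)
  * \prod_k \prod_l pair_weight pos alpha h e f k l.

Definition step_monomial alpha h f : {mpoly F[n]} :=
  \prod_(k | (h < alpha k)%N) 'X_(f k).

(** A word has a letter in every column, also in those that end at row [h] or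
    below; fixing that letter to a default [d] makes each filling appear
    exactly once. *)
Definition blank_above (d : 'I_n) alpha h f : bool :=
  [forall k, (alpha k <= h)%N ==> (f k == d)].

(** The generating function of the rows [h.+1], ..., [h + m] above a row [h]
    that reads [e]. *)
Fixpoint transfer pos alpha (d : 'I_n) m h e : {mpoly F[n]} :=
  if m is m'.+1 then
    \sum_(f | blank_above d alpha h f)
      step_weight pos alpha h e f
      *: (step_monomial alpha h f * transfer pos alpha d m' h.+1 f)
  else 1.

Section Relabel.
Context (i j : 'I_n).
Local Notation s := (tperm i j).

Lemma swap_wordK : involutive (@swap_word n i j).
Proof. by move=> e; apply/ffunP => k; rewrite !ffunE tpermK. Qed.

Lemma reindex_tperm (R : Type) (idx : R) (op : Monoid.com_law idx)
    (P : pred 'I_n) (D : 'I_n -> R) :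
  \big[op/idx]_(k | P k) D k = \big[op/idx]_(k | P (s k)) D (s k).
Proof. by rewrite (reindex_inj (@perm_inj _ s)). Qed.

Lemma step_weight_relabel alpha h e f :
  step_weight id (swap_parts i j alpha) h e f =
  step_weight s alpha h (swap_word i j e) (swap_word i j f).
Proof.
rewrite /step_weight; congr (_ * _).
  rewrite reindex_tperm; apply: eq_bigr => k _.
  rewrite /box_weight /arm_size reindex_tperm.
  under eq_bigr => l _ do rewrite /in_arm !ffunE !tpermK.
  by rewrite !ffunE !tpermK.
rewrite reindex_tperm; apply: eq_bigr => k _.
rewrite reindex_tperm; apply: eq_bigr => l _.
by rewrite /pair_weight /compatible /step_coinv /in_arm !ffunE !tpermK
  !(inj_eq (@perm_inj _ _)).
Qed.

Lemma step_monomial_relabel alpha h f :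
  step_monomial (swap_parts i j alpha) h f =
  step_monomial alpha h (swap_word i j f).
Proof.
by rewrite /step_monomial reindex_tperm; apply: eq_big => k;
  rewrite !ffunE tpermK.
Qed.

Lemma blank_above_relabel d alpha h f :
  blank_above d (swap_parts i j alpha) h f =
  blank_above d alpha h (swap_word i j f).
Proof.
by apply/forallP/forallP => H k; have := H (s k); rewrite !ffunE ?tpermK.
Qed.

(** Renaming columns [i] and [j] turns the swapped diagram into the original
    one, at the price of changing which of the two columns is on the left. *)
Lemma transfer_relabel d alpha m h e :
  transfer id (swap_parts i j alpha) d m h e =
  transfer s alpha d m h (swap_word i j e).
Proof.
elim: m h e => //= m IH h e.
rewrite [RHS](reindex_inj (inv_inj swap_wordK)).
apply: eq_big => f; rewrite blank_above_relabel // => _.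
by rewrite step_weight_relabel step_monomial_relabel IH.
Qed.
End Relabel.
End Transfer.

(** * The influence of a third column *)

(** Over the integers the coinversion indicator is an affine function of chi's,
    so that exponents of t can be compared by ring computations. *)
Lemma coinv_tripleE {n} (a b c : 'I_n) :
  (coinv_triple a b c)%:Z = 1 - (chi a b)%:Z - (chi b c)%:Z + (chi a c)%:Z.
Proof. by rewrite /coinv_triple /chi3 /chi; lia. Qed.

Lemma chiC {n} (a b : 'I_n) : a != b -> (chi a b)%:Z = 1 - (chi b a)%:Z.
Proof. by rewrite -val_eqE /chi /=; lia. Qed.

Section Exchange.
Context {n : nat} (i j : 'I_n) (alpha : composition n).
Context (hij : j = i.+1 :> nat).
Context (halpha : (alpha j < alpha i)%N).
Implicit Types (h : nat) (e f : word n) (k l : 'I_n).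

Local Notation s := (tperm i j).
Local Notation swap := (swap_word i j).

(** The contribution of column [l] to twinv (s alpha) sigma - twinv alpha sigma
    when [e] is the basement, see [twinv_drift].  The columns that contribute
    are those whose height separates the two heights. *)
Definition drift e l : int :=
  if [&& (l < i)%N, (alpha j <= alpha l)%N & (alpha l < alpha i)%N]
  then (chi (e i) (e l))%:Z - (chi (e j) (e l))%:Z
  else if [&& (j < l)%N, (alpha j < alpha l)%N & (alpha l <= alpha i)%N]
  then (chi (e l) (e j))%:Z - (chi (e l) (e i))%:Z
  else 0.

Definition other l := (l != i) && (l != j).

Definition side_compatible h e f l : bool :=
  (compatible id alpha h e f i l && compatible id alpha h e f j l)
  && (compatible id alpha h e f l i && compatible id alpha h e f l j).

Definition side_coinv h e f l : nat :=
  (step_coinv id alpha h e f i l + step_coinv id alpha h e f j l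
  + (step_coinv id alpha h e f l i + step_coinv id alpha h e f l j))%N.

(** The coinversions that column [l] forms with columns [i] and [j], less one
    for each descent of [i] or [j] whose arm meets column [l]: that power of t
    is merged with the weight of the descent, see [move_weightM]. *)
Definition side_excess h e f l : int :=
  (side_coinv h e f l)%:Z - (in_arm id alpha h i l * chi (f i) (e i))%:Z
  - (((h < alpha j)%N && in_arm id alpha h j l) * chi (f j) (e j))%:Z.

Lemma other_side l : other l ->
  (l < i)%N && (l < j)%N && ~~ (i < l)%N && ~~ (j < l)%N
  || (i < l)%N && (j < l)%N && ~~ (l < i)%N && ~~ (l < j)%N.
Proof. by rewrite /other -!val_eqE /=; clear halpha; lia. Qed.

Lemma swap_other e l : other l -> swap e l = e l.
Proof. by case/andP=> li lj; rewrite ffunE tpermD // eq_sym. Qed.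
Lemma swap_i e : swap e i = e j. Proof. by rewrite ffunE tpermL. Qed.
Lemma swap_j e : swap e j = e i. Proof. by rewrite ffunE tpermR. Qed.

Lemma side_compatible_swap_below h e f l : (h <= alpha j)%N -> other l ->
  side_compatible h (swap e) f l = side_compatible h e f l.
Proof.
move=> hj ol; have /orP := other_side ol; case/andP: (ol) => li lj.
have hi : (h < alpha i)%N by lia.
rewrite /side_compatible /compatible !swap_i !swap_j !swap_other //.
rewrite ![_ == l]eq_sym li lj hj hi (ltnW hi) /=.
case=> /andP[/andP[/andP[-> ->] /negbTE->] /negbTE->] //=;
case: (h < alpha l)%N => //=; case: (f l == e i); case: (f l == e j) => /=;
  rewrite ?andbF ?andbT //.
Qed.

Lemma side_compatible_swap_above h e f l : (h < alpha j)%N -> other l ->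
  side_compatible h e (swap f) l = side_compatible h e f l.
Proof.
move=> hj ol; have /orP := other_side ol; case/andP: (ol) => li lj.
have hi : (h < alpha i)%N by lia.
rewrite /side_compatible /compatible !swap_i !swap_j !swap_other //.
rewrite ![_ == l]eq_sym li lj hj hi (ltnW hi) (ltnW hj) /=.
case=> /andP[/andP[/andP[-> ->] /negbTE->] /negbTE->] //=;
rewrite !andbF /= ?andbT ![f l == f _]eq_sym;
case: (h < alpha l)%N; case: (h <= alpha l)%N => //=; rewrite ?andbT //;
case: (f i == f l); case: (f j == f l); rewrite ?andbF ?andbT //=;
case: (f i == e l); case: (f j == e l) => //=.
Qed.

Definition distinct_active h e : bool :=
  [forall k, forall l,
     [&& h <= alpha k, h <= alpha l & k != l]%N ==> (e k != e l)].

(** Exchanging the lower entries of the tall and the short column changes the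
    excess of column [l] by its drift: once chi a b is rewritten as 1 - chi b a
    between the lower entry of [l] and these two, everything cancels. *)
Lemma drift_side_excess_below h e f l : (h <= alpha j)%N -> other l ->
  distinct_active h e -> side_compatible h e f l ->
  drift e l + side_excess h (swap e) f l = side_excess h e f l.
Proof.
move=> hj ol he; have /orP := other_side ol; case/andP: (ol) => li lj.
have hi : (h < alpha i)%N by lia.
have eli : (h <= alpha l)%N -> e l != e i.
  move=> hl; have /forallP/(_ l)/forallP/(_ i) := he.
  by rewrite li (ltnW hi) hl.
have elj : (h <= alpha l)%N -> e l != e j.
  move=> hl; have /forallP/(_ l)/forallP/(_ j) := he.
  by rewrite lj hj hl.
(* The possible positions of alpha l relative to h, alpha j and alpha i, as
   implications between the comparisons that remain when l is on the left
   (Fl) or on the right (Fr) of the two columns. *)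
have Fl1 : (h < alpha l)%N ==> (h <= alpha l)%N by apply/implyP/ltnW.
have Fl2 : (alpha l < alpha j)%N ==> (alpha l < alpha i)%N by lia.
have Fl3 : ~~ (h <= alpha l)%N ==> (alpha l < alpha j)%N by lia.
have Fl4 : [|| h < alpha j, ~~ (alpha l < alpha j) | ~~ (h <= alpha l)]%N.
  by lia.
have Fr3 : [|| h < alpha j, alpha j < alpha l | ~~ (h < alpha l)]%N by lia.
have Fr1 : (alpha i < alpha l)%N ==> (alpha j < alpha l)%N by lia.
have Fr2 : (alpha j < alpha l)%N ==> (h < alpha l)%N by lia.
rewrite /side_compatible /side_excess /side_coinv /drift /step_coinv.
rewrite /compatible /in_arm !swap_i !swap_j !swap_other //.
rewrite ![_ == l]eq_sym li lj hj hi (ltnW hi) /=.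
case=> /andP[/andP[/andP[-> ->] /negbTE->] /negbTE->] //=;
rewrite ?andbT ?orbF ?andbF ?implybF !PoszD.
  rewrite (leqNgt (alpha j) (alpha l)) (leqNgt (alpha i) (alpha l)).
  move: Fl1 Fl2 Fl3 Fl4 eli elj.
  case: (h < alpha j)%N;
  case: (h <= alpha l)%N; case: (h < alpha l)%N => //=;
  case: (alpha l < alpha j)%N; case: (alpha l < alpha i)%N => //= _ _ _ _;
  move=> /(_ isT) eli /(_ isT) elj _; rewrite !coinv_tripleE ?mul0n ?mul1n;
  rewrite ?(chiC eli) ?(chiC elj); ring.
rewrite (leqNgt (alpha l) (alpha j)) (leqNgt (alpha l) (alpha i)).
have {}Fl1 := implyP Fl1; have {}eli := fun x => eli (Fl1 x).
have {}elj := fun x => elj (Fl1 x).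
move: Fr1 Fr2 Fr3 eli elj.
case: (h < alpha j)%N;
case: (h < alpha l)%N => //=;
case: (alpha j < alpha l)%N; case: (alpha i < alpha l)%N => //= _ _ _;
move=> /(_ isT) eli /(_ isT) elj _; rewrite !coinv_tripleE ?mul0n ?mul1n;
rewrite ?(chiC eli) ?(chiC elj); ring.
Qed.

(** The same for the upper entries.  Here chi a b can be rewritten as
    1 - chi b a thanks to the non-attacking conditions between [l] and the new
    entries. *)
Lemma drift_side_excess_above h e f l : (h < alpha j)%N -> other l ->
  side_compatible h e f l ->
  drift (swap f) l + side_excess h e (swap f) l = side_excess h e f l.
Proof.
move=> hj ol; have /orP := other_side ol; case/andP: (ol) => li lj.
have hi : (h < alpha i)%N by lia.
have Fl1 : (h < alpha l)%N ==> (h <= alpha l)%N by apply/implyP/ltnW.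
have Fl2 : (alpha l < alpha j)%N ==> (alpha l < alpha i)%N by lia.
have Fl3 : ~~ (h < alpha l)%N ==> (alpha l < alpha j)%N by lia.
have Fr1 : (alpha i < alpha l)%N ==> (alpha j < alpha l)%N by lia.
have Fr2 : (alpha j < alpha l)%N ==> (h < alpha l)%N by lia.
rewrite /side_compatible /side_excess /side_coinv /drift /step_coinv.
rewrite /compatible /in_arm !swap_i !swap_j !swap_other //.
rewrite ![_ == l]eq_sym li lj hj hi (ltnW hi) /=.
case=> /andP[/andP[/andP[-> ->] /negbTE->] /negbTE->] //=;
rewrite ?andbT ?orbF ?andbF ?implybF ?(eq_sym (f l)) !PoszD.
  case/andP=> /andP[/andP[Nii Nie] /andP[Nji Nje]] _.
  rewrite (leqNgt (alpha j) (alpha l)) (leqNgt (alpha i) (alpha l)).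
  move: Fl1 Fl2 Fl3 Nii Nie Nji Nje.
  case: (h < alpha l)%N; case: (h <= alpha l)%N => //=;
  case: (alpha l < alpha j)%N; case: (alpha l < alpha i)%N => //= _ _ _;
  move=> Nii Nie Nji Nje;
  rewrite !coinv_tripleE ?mul0n ?mul1n;
  rewrite ?(chiC Nii) ?(chiC Nie) ?(chiC Nji) ?(chiC Nje); ring.
case/andP=> /andP[/andP[Nii _] /andP[Nji _]] /andP[/andP[_ Nie] /andP[_ Nje]].
rewrite (leqNgt (alpha l) (alpha j)) (leqNgt (alpha l) (alpha i)).
move: Fl3 Fr1 Fr2 Nii Nie Nji Nje.
case: (h < alpha l)%N => //=;
case: (alpha j < alpha l)%N; case: (alpha i < alpha l)%N => //= _ _ _;
move=> Nii Nie Nji Nje;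
rewrite !coinv_tripleE ?mul0n ?mul1n;
rewrite ?(chiC Nii) ?(chiC Nie) ?(chiC Nji) ?(chiC Nje); ring.
Qed.
End Exchange.

(** * Two columns alone *)

Section TwoColumns.
Context {F : fieldType} (t : F) {n : nat}.
Implicit Types (p r : 'I_n) (z y x : F).
Context (t_nz : t != 0).

(** The coefficient c without the power of t coming from third columns: the case
    [p < r] has one factor t less because the pair (i, j) itself then counts in
    twinv alpha sigma. *)
Definition swap_factor z p r : F :=
  (1 - t) / (1 - z) * (if (r < p)%N then 1 else z / t).

(** The weight of a step for the two columns alone, the tall one moving from [p]
    to [p'] and standing on the left, the short one from [r] to [r'].  The
    parameters q^(leg + 1) t^(arm + 1) of their boxes are [z * y] and [y].  A
    descent carries q^(leg + 1) and one t for each third column in the arm,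
    which is [y / t] for the short column, but [z * y / t ^+ 2] for the tall
    one, whose arm contains the box of the short column as well. *)
Definition pair_left z y p r (p' r' : 'I_n) : F :=
  move_weight t (z * y) (z * y / t ^+ 2) p p' * move_weight t y (y / t) r r'
  * (((p' != r') && (r' != p))%:R * t ^+ coinv_triple p' r' p).

Definition pair_right z y p r (p' r' : 'I_n) : F :=
  move_weight t (z * y) (z * y / t ^+ 2) p p' * move_weight t y (y / t) r r'
  * (((p' != r') && (p' != r))%:R * t ^+ coinv_triple p' r p).

(** Everything depends on the relative order of the four entries only, and for
    each order this is an identity of rational functions in t, y and z. *)
Lemma pair_exchange z y p r (p' r' : 'I_n) :
  1 - z != 0 -> 1 - y != 0 -> 1 - z * y != 0 -> p != r ->
  pair_left z y p r p' r' + swap_factor z r' p' * pair_left z y p r r' p' =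
  pair_right z y p r p' r' + swap_factor z p r * pair_right z y r p p' r'.
Proof.
move=> z0 y0 zy0.
rewrite /pair_left /pair_right /swap_factor /move_weight /coinv_triple.
rewrite /chi3 /chi -!val_eqE /=.
move: (p : nat) (r : nat) (p' : nat) (r' : nat) => {}p {}r {}p' {}r'.
case: (ltngtP p r) => // h1 _; case: (ltngtP p' r') => h2;
case: (ltngtP p p') => h3; try (exfalso; lia);
case: (ltngtP p r') => h4; try (exfalso; lia);
case: (ltngtP r p') => h5; try (exfalso; lia);
case: (ltngtP r r') => h6; try (exfalso; lia);
rewrite /= ?addn0 ?add0n ?subnn ?subn0 ?expr0 ?expr1;
rewrite ?mulr1 ?mul1r ?mulr0 ?mul0r ?addr0 ?add0r //.
all: by field; rewrite ?t_nz ?z0 ?y0 ?zy0.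
Qed.

(** The step that leaves the short column: only the tall column moves.  On the
    right of the short column its arm has one more box, the top box of the
    short column, whence the parameter [z * t] in [top_right]. *)
Definition top_left z p (p' : 'I_n) : F := move_weight t z (z / t) p p'.

Definition top_right z p r (p' : 'I_n) : F :=
  move_weight t (z * t) (z / t) p p'
  * ((p' != r)%:R * t ^+ coinv_triple p' r p).

Lemma top_exchange z p r (p' : 'I_n) :
  1 - z != 0 -> 1 - z * t != 0 -> p != r ->
  top_left z p p' = top_right z p r p' + swap_factor z p r * top_right z r p p'.
Proof.
move=> z0 zt0.
rewrite /top_left /top_right /swap_factor /move_weight /coinv_triple.
rewrite /chi3 /chi -!val_eqE /=.
move: (p : nat) (r : nat) (p' : nat) => {}p {}r {}p'.
case: (ltngtP p r) => // h1 _; case: (ltngtP p p') => h3;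
case: (ltngtP r p') => h5; try (exfalso; lia);
rewrite /= ?addn0 ?add0n ?subnn ?subn0 ?expr0 ?expr1;
rewrite ?mulr1 ?mul1r ?mulr0 ?mul0r ?addr0 ?add0r //.
all: by field; rewrite ?t_nz ?z0 ?zt0.
Qed.

Lemma move_weightM z x y m p (p' : 'I_n) :
  move_weight t z x p p' * y ^+ (m * chi p' p)
  = move_weight t z (x * y ^+ m) p p'.
Proof.
rewrite /move_weight; case: eqP => [->|_].
  by rewrite /chi ltnn muln0 mulr1.
by rewrite exprMn exprM mulrA.
Qed.
End TwoColumns.

(** * Exchanging the order of two adjacent columns *)

Section Positions.
Context {n : nat} (i j : 'I_n).
Context (hij : j = i.+1 :> nat).
Implicit Types (k l : 'I_n).
Local Notation s := (tperm i j).
Local Notation other := (other i j).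

Lemma neq_ij : i != j.
Proof. by rewrite -val_eqE /= hij ltn_eqF. Qed.

Lemma neq_ji : j != i. Proof. by rewrite eq_sym neq_ij. Qed.

(** Since [i] and [j] are adjacent, exchanging them affects no comparison with a
    third column. *)
Lemma s_other k l : other k || other l -> (s k < s l)%N = (k < l)%N.
Proof.
have other_s m : other m -> s m = m.
  by case/andP=> mi mj; rewrite tpermD // eq_sym.
move=> /orP[] ok; have := other_side hij ok; rewrite (other_s _ ok);
 case: tpermP => [->|->|] //; lia.
Qed.

Variant id_or_swap (pos : 'I_n -> 'I_n) : Prop :=
  | ColumnOrderId of pos = id | ColumnOrderSwap of pos = s.

Lemma pos_other pos k l : id_or_swap pos -> other k || other l ->
  (pos k < pos l)%N = (k < l)%N.
Proof. by case=> -> //; apply: s_other. Qed.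

Lemma s_i_j : (s i < s j)%N = false /\ (s j < s i)%N.
Proof. by rewrite tpermL tpermR hij ltnSn ltnNge leqnSn. Qed.

End Positions.

Section StepExchange.
Context {F : fieldType} (q t : F) {n : nat} (i j : 'I_n).
Context (alpha : composition n).
Context (hij : j = i.+1 :> nat).
Context (halpha : (alpha j < alpha i)%N).
Context (t_nz : t != 0).
Context (generic : forall a b, 1 - q ^+ a * t ^+ b.+1 != 0).
Implicit Types (h : nat) (e f : word n) (k l : 'I_n).

Local Notation s := (tperm i j).
Local Notation swap := (swap_word i j).
Local Notation other := (other i j).

Lemma in_arm_other pos h k l : id_or_swap i j pos -> other k || other l ->
  in_arm pos alpha h k l = in_arm id alpha h k l.
Proof. by move=> hp okl; rewrite /in_arm !(pos_other hij) // orbC. Qed.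

Lemma pair_weight_other pos h e f k l :
  id_or_swap i j pos -> other k || other l ->
  pair_weight t pos alpha h e f k l = pair_weight t id alpha h e f k l.
Proof.
move=> hp okl; rewrite /pair_weight /compatible /step_coinv in_arm_other //.
by rewrite (pos_other hij) // orbC.
Qed.

Lemma box_weight_other pos h e f k : id_or_swap i j pos -> other k ->
  box_weight q t pos alpha h e f k = box_weight q t id alpha h e f k.
Proof.
move=> hp ok; rewrite /box_weight /arm_size.
by under eq_bigr => l _ do rewrite in_arm_other ?ok //.
Qed.

(** The part of a step weight in which columns [i] and [j] do not occur. *)
Definition common h e f : F :=
  (\prod_(k | other k) box_weight q t id alpha h e f k)
  * \prod_(k | other k) \prod_(l | other l) pair_weight t id alpha h e f k l.

Lemma common_swapr h e f : common h e (swap f) = common h e f.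
Proof.
congr (_ * _); apply: eq_bigr => k ok.
  by rewrite /box_weight swap_other.
apply: eq_bigr => l ol; rewrite /pair_weight /compatible /step_coinv.
by rewrite !swap_other.
Qed.

Lemma common_swapl h e f : common h (swap e) f = common h e f.
Proof.
congr (_ * _); apply: eq_bigr => k ok.
  by rewrite /box_weight swap_other.
apply: eq_bigr => l ol; rewrite /pair_weight /compatible /step_coinv.
by rewrite !swap_other.
Qed.

Definition excess h e f : int :=
  \sum_(l | other l) side_excess i j alpha h e f l.
Definition total_drift e : int := \sum_(l | other l) drift i j alpha e l.
Definition all_compatible h e f : bool :=
  [forall l, other l ==> side_compatible i j alpha h e f l].

(** These leave out the box that columns [i] and [j] may have in each other's
    arms: that one depends on the order of the two columns. *)
Definition tall_arm h : nat := (\sum_(l | other l) in_arm id alpha h i l)%N.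
Definition short_arm h : nat :=
  (\sum_(l | other l) ((h < alpha j)%N && in_arm id alpha h j l))%N.

Lemma expfz_sum (P : pred 'I_n) (D : 'I_n -> int) :
  t ^ (\sum_(l | P l) D l) = \prod_(l | P l) t ^ D l.
Proof.
apply: (big_morph (fun z : int => t ^ z)) => [x y|].
  by rewrite expfzDr.
by rewrite expr0z.
Qed.

Lemma prod_indicator (P b : pred 'I_n) :
  \prod_(l | P l) ((b l)%:R : F) = [forall l, P l ==> b l]%:R.
Proof.
case: forallP => [H|/forallP].
  by apply: big1 => l Pl; have /implyP-> := H l.
rewrite negb_forall => /existsP[l]; rewrite negb_imply => /andP[Pl nbl].
by rewrite (bigD1 l) //= (negbTE nbl) mul0r.
Qed.

Lemma side_prodE h e f :
  \prod_(l | other l)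
     (pair_weight t id alpha h e f i l * pair_weight t id alpha h e f j l
      * (pair_weight t id alpha h e f l i * pair_weight t id alpha h e f l j))
  = (all_compatible h e f)%:R * t ^ excess h e f
    * (t ^+ (tall_arm h * chi (f i) (e i))
       * t ^+ (short_arm h * chi (f j) (e j))).
Proof.
have big_expn (D : 'I_n -> nat) c :
    t ^+ ((\sum_(l | other l) D l) * c)%N
    = \prod_(l | other l) t ^+ (D l * c)%N.
  by rewrite big_distrl /= (big_morph _ (exprD t) (expr0 t)).
rewrite -prod_indicator /excess expfz_sum /tall_arm /short_arm.
rewrite !big_expn -!big_split /=; apply: eq_bigr => l ol.
rewrite /pair_weight /side_compatible /side_excess.
set A := (in_arm _ _ _ i l * _)%N; set B := (_ * chi (f j) (e j))%N.
have tE : t ^ ((side_coinv i j alpha h e f l)%:Z - A%:Z - B%:Z)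
    * (t ^+ A * t ^+ B) = t ^+ side_coinv i j alpha h e f l.
  by rewrite !exprnP -!expfzDr //; congr (_ ^ _); ring.
rewrite -[RHS]mulrA tE /side_coinv !exprD -!mulnb !natrM.
move: (t ^+ step_coinv _ _ _ _ _ i l) (t ^+ step_coinv _ _ _ _ _ j l) => x y.
move: (t ^+ step_coinv _ _ _ _ _ l i) (t ^+ step_coinv _ _ _ _ _ l j) => z w.
ring.
Qed.

Lemma all_compatible_below h e f : (h <= alpha j)%N ->
  all_compatible h (swap e) f = all_compatible h e f.
Proof.
move=> hj; apply: eq_forallb => l; case ol: (other l) => //=.
exact: side_compatible_swap_below.
Qed.

Lemma all_compatible_above h e f : (h < alpha j)%N ->
  all_compatible h e (swap f) = all_compatible h e f.
Proof.
move=> hj; apply: eq_forallb => l; case ol: (other l) => //=.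
exact: side_compatible_swap_above.
Qed.

Lemma excess_below h e f : (h <= alpha j)%N -> distinct_active alpha h e ->
  all_compatible h e f -> total_drift e + excess h (swap e) f = excess h e f.
Proof.
move=> hj de /forallP ce; rewrite -big_split /=; apply: eq_bigr => l ol.
by apply: drift_side_excess_below => //; apply: implyP (ce l) ol.
Qed.

Lemma excess_above h e f : (h < alpha j)%N ->
  all_compatible h e f ->
  total_drift (swap f) + excess h e (swap f) = excess h e f.
Proof.
move=> hj /forallP ce; rewrite -big_split /=; apply: eq_bigr => l ol.
by apply: drift_side_excess_above => //; apply: implyP (ce l) ol.
Qed.

(** The factor of a step weight due to third columns. *)
Definition environment h e f : F :=
  common h e f * ((all_compatible h e f)%:R * t ^ excess h e f).

Lemma environment_below h e f : (h <= alpha j)%N -> distinct_active alpha h e ->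
  t ^ total_drift e * environment h (swap e) f = environment h e f.
Proof.
move=> hj de; rewrite /environment common_swapl all_compatible_below //.
case ce: (all_compatible h e f); last by rewrite !mul0r !mulr0.
by rewrite !mul1r -(excess_below hj de ce) expfzDr // mulrCA.
Qed.

Lemma environment_above h e f : (h < alpha j)%N ->
  t ^ total_drift (swap f) * environment h e (swap f) = environment h e f.
Proof.
move=> hj; rewrite /environment common_swapr all_compatible_above //.
case ce: (all_compatible h e f); last by rewrite !mul0r !mulr0.
by rewrite !mul1r -(excess_above hj ce) expfzDr // mulrCA.
Qed.

(** The third columns that are in the arm of the tall box of a row and not in
    that of the short box have a height between the two heights: they are the
    same for all rows up to [alpha j]. *)
Lemma tall_armE h : (h <= alpha j)%N ->
  tall_arm h = (short_arm h + tall_arm (alpha j))%N.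
Proof.
move=> hj; rewrite /tall_arm /short_arm -big_split /=; apply: eq_bigr => l ol.
have /orP := other_side hij ol; rewrite /in_arm.
by case=> /andP[/andP[/andP[-> ->] /negbTE->] /negbTE->] /=;
  clear -hj halpha; lia.
Qed.

Lemma arm_size_tall pos h : id_or_swap i j pos ->
  arm_size pos alpha h i = (in_arm pos alpha h i j + tall_arm h)%N.
Proof.
move=> hp; rewrite /arm_size (big_outside_pair _ (neq_ij hij)) /=.
congr (_ + _)%N.
  by rewrite /in_arm !ltnn.
by apply: eq_bigr => l ol; rewrite in_arm_other // /other ol orbT.
Qed.

Lemma step_weight_split pos h e f : id_or_swap i j pos ->
  step_weight q t pos alpha h e f =
  environment h e f
  * ((box_weight q t pos alpha h e f i * t ^+ (tall_arm h * chi (f i) (e i)))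
    * (box_weight q t pos alpha h e f j * t ^+ (short_arm h * chi (f j) (e j)))
    * (pair_weight t pos alpha h e f i j * pair_weight t pos alpha h e f j i)).
Proof.
move=> hp; rewrite /step_weight (big_outside_pair _ (neq_ij hij)).
rewrite (big2_outside_pair _ (neq_ij hij)) /=.
have diag k : pair_weight t pos alpha h e f k k = 1.
  rewrite /pair_weight /compatible /step_coinv /in_arm eqxx !ltnn.
  by rewrite !andbF mul1r.
rewrite !diag.
have boxE : \prod_(k | (k != i) && (k != j)) box_weight q t pos alpha h e f k
    = \prod_(k | other k) box_weight q t id alpha h e f k.
  by apply: eq_bigr => k ok; apply: box_weight_other.
have sideE := side_prodE h e f.
have {}sideE : \prod_(l | (l != i) && (l != j))
     (pair_weight t pos alpha h e f i l * pair_weight t pos alpha h e f j l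
      * (pair_weight t pos alpha h e f l i * pair_weight t pos alpha h e f l j))
    = (all_compatible h e f)%:R * t ^ excess h e f
    * (t ^+ (tall_arm h * chi (f i) (e i))
       * t ^+ (short_arm h * chi (f j) (e j))).
  rewrite -sideE; apply: eq_bigr => l ol.
  by congr (_ * _ * (_ * _)); rewrite pair_weight_other // /other ol ?orbT.
have restE : \prod_(k | (k != i) && (k != j)) \prod_(l | (l != i) && (l != j))
      pair_weight t pos alpha h e f k l
    = \prod_(k | other k) \prod_(l | other l) pair_weight t id alpha h e f k l.
  apply: eq_bigr => k ok; apply: eq_bigr => l ol.
  by apply: pair_weight_other => //; apply/orP; left.
rewrite boxE sideE restE /environment /common.
move: (\prod_(k | other k) _) (\prod_(k | other k) \prod_(l | _) _) => A B.
move: (box_weight _ _ _ _ _ _ _ i) (box_weight _ _ _ _ _ _ _ j) => bi bj.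
move: (pair_weight _ _ _ _ _ _ i j) (pair_weight _ _ _ _ _ _ j i) => pij pji.
move: (_%:R) (t ^ _) (t ^+ _) (t ^+ (short_arm h * _)) => c x y z.
ring.
Qed.

Lemma arm_size_short pos h : (h < alpha j)%N -> id_or_swap i j pos ->
  arm_size pos alpha h j = short_arm h.
Proof.
move=> hj hp; rewrite /arm_size (big_outside_pair _ (neq_ij hij)) /=.
rewrite /in_arm !ltnn [(alpha i < alpha j)%N]ltnNge (ltnW halpha).
rewrite [(alpha i <= alpha j)%N]leqNgt halpha !andbF !add0n.
apply: eq_bigr => l ol; rewrite hj /=.
by have := @in_arm_other pos h j l hp; rewrite /other ol orbT => /(_ isT) <-.
Qed.

(** The parameter q^(leg + 1) t^(arm + 1) of the short box in row [h.+1]. *)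
Definition short_factor h : F := q ^+ (alpha j - h) * t ^+ (short_arm h).+1.

(** The parameter q^(leg u + 1) t^(arm u) in the theorem, see [swap_ratioE]. *)
Definition swap_ratio : F :=
  q ^+ (alpha i - alpha j) * t ^+ (tall_arm (alpha j)).+1.

(** In a row that meets both columns, the right-hand side is the parameter
    q^(leg + 1) t^(arm + 1) of the tall box for either order of the columns: its
    arm contains one box of the short column, from the same row if the tall
    column is on the left and from the row below if it is on the right. *)
Lemma factorM h : (h <= alpha j)%N ->
  swap_ratio * short_factor h = q ^+ (alpha i - h) * t ^+ (tall_arm h).+2.
Proof.
move=> hj; rewrite /swap_ratio /short_factor mulrACA -!exprD (tall_armE hj).
by congr (_ ^+ _ * _ ^+ _); clear -hj halpha; lia.
Qed.

Lemma factor_tall_env a m : q ^+ a * t ^+ m.+2 / t ^+ 2 = q ^+ a * t ^+ m.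
Proof. by rewrite 2!exprS; field. Qed.

Lemma factor_short_env h :
  short_factor h / t = q ^+ (alpha j - h) * t ^+ short_arm h.
Proof. by rewrite /short_factor exprS; field. Qed.

Lemma swap_ratio_env :
  swap_ratio / t = q ^+ (alpha i - alpha j) * t ^+ tall_arm (alpha j).
Proof. by rewrite /swap_ratio exprS; field. Qed.

Lemma step_weight_left h e f : (h < alpha j)%N ->
  step_weight q t id alpha h e f =
  environment h e f
  * pair_left t swap_ratio (short_factor h) (e i) (e j) (f i) (f j).
Proof.
move=> hj; rewrite (@step_weight_split id); last by left.
congr (_ * _); rewrite /pair_left; have hi := ltn_trans hj halpha.
have lt_ij : (i < j)%N by rewrite hij.
have lt_ji : (j < i)%N = false by rewrite hij ltnNge leqnSn.
congr (_ * _).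
  rewrite /box_weight hi hj !move_weightM.
  rewrite (@arm_size_tall id) ?(@arm_size_short id) //; try by left.
  rewrite factorM ?(ltnW hj) // /in_arm lt_ij lt_ji (ltnW halpha) hj add1n.
  by rewrite factor_tall_env factor_short_env.
rewrite /pair_weight /compatible /step_coinv /in_arm hi hj lt_ij lt_ji.
rewrite (neq_ij hij) (neq_ji hij) (ltnW halpha) (ltnW hi) !andbF /= andbT.
rewrite [f j == f i]eq_sym.
rewrite [(alpha i < alpha j)%N]ltnNge (ltnW halpha) /=.
by case: (f i == f j); rewrite /= ?mul0r ?mul1r ?mulr1 // mulrC.
Qed.

Lemma step_weight_right h e f : (h < alpha j)%N ->
  step_weight q t s alpha h e f =
  environment h e f
  * pair_right t swap_ratio (short_factor h) (e i) (e j) (f i) (f j).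
Proof.
move=> hj; rewrite (@step_weight_split s); last by right.
congr (_ * _); rewrite /pair_right; have hi := ltn_trans hj halpha.
have [s_ij s_ji] := s_i_j hij.
congr (_ * _).
  rewrite /box_weight hi hj !move_weightM.
  rewrite (@arm_size_tall s) ?(@arm_size_short s) //; try by right.
  rewrite factorM ?(ltnW hj) // /in_arm s_ij s_ji halpha (ltnW hj) add1n.
  by rewrite factor_tall_env factor_short_env.
rewrite /pair_weight /compatible /step_coinv /in_arm hi hj s_ij s_ji.
rewrite (neq_ij hij) (neq_ji hij) halpha (ltnW hi) (ltnW hj) /=.
rewrite [f j == f i]eq_sym.
rewrite [(alpha i <= alpha j)%N]leqNgt halpha /= andbT.
by case: (f i == f j); rewrite /= ?mul0r ?mul1r ?mulr1 ?mulr0 // mulrC.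
Qed.

Lemma step_weight_top_left e f :
  step_weight q t id alpha (alpha j) e f =
  environment (alpha j) e f * top_left t swap_ratio (e i) (f i).
Proof.
rewrite (@step_weight_split id); last by left.
congr (_ * _); rewrite /top_left.
have lt_ij : (i < j)%N by rewrite hij.
have lt_ji : (j < i)%N = false by rewrite hij ltnNge leqnSn.
have -> : short_arm (alpha j) = 0%N by rewrite /short_arm ltnn big1.
rewrite /box_weight halpha ltnn !mul0n mulr1 mulr1 move_weightM.
rewrite (@arm_size_tall id); last by left.
rewrite /pair_weight /compatible /step_coinv /in_arm halpha ltnn lt_ij lt_ji /=.
rewrite ?andbF !mulr1.
by rewrite swap_ratio_env.
Qed.

Lemma step_weight_top_right e f :
  step_weight q t s alpha (alpha j) e f =
  environment (alpha j) e f * top_right t swap_ratio (e i) (e j) (f i).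
Proof.
rewrite (@step_weight_split s); last by right.
congr (_ * _); rewrite /top_right.
have [s_ij s_ji] := s_i_j hij.
have -> : short_arm (alpha j) = 0%N by rewrite /short_arm ltnn big1.
rewrite /box_weight halpha ltnn !mul0n mulr1 mulr1 move_weightM.
rewrite (@arm_size_tall s); last by right.
rewrite /pair_weight /compatible /step_coinv /in_arm halpha ltnn leqnn.
rewrite s_ij s_ji /= ?andbF !mulr1.
by rewrite add1n swap_ratio_env /swap_ratio -[_ * _ * t]mulrA -exprSr.
Qed.

(** * The exchange relation *)

(** The coefficient c as a function of the word in the current row; at the
    basement it is the coefficient of the theorem, see [swap_coefE]. *)
Definition exchange_coef e : F :=
  t ^ total_drift e * swap_factor t swap_ratio (e i) (e j).

Lemma ratio_neq1 : 1 - swap_ratio != 0. Proof. exact: generic. Qed.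

(** The four terms are the coefficients of G_s in row [h.+1] on the two sides of
    the exchange relation in row [h]; they share the same environment. *)
Lemma step_exchange h e f : (h < alpha j)%N -> distinct_active alpha h e ->
  step_weight q t id alpha h e f
  + exchange_coef (swap f) * step_weight q t id alpha h e (swap f)
  = step_weight q t s alpha h e f
    + exchange_coef e * step_weight q t s alpha h (swap e) f.
Proof.
move=> hj de; rewrite !step_weight_left // !step_weight_right //.
rewrite /exchange_coef !swap_i !swap_j.
rewrite [X in _ + X = _]mulrACA [X in _ = _ + X]mulrACA.
rewrite environment_above // environment_below // ?(ltnW hj) //.
rewrite -!mulrDr; congr (_ * _).
apply: (pair_exchange t_nz); first exact: ratio_neq1.
- exact: generic.
- by rewrite factorM ?(ltnW hj) //; apply: generic.
have /forallP/(_ i)/forallP/(_ j) := de.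
by rewrite (neq_ij hij) (ltnW hj) (ltnW (ltn_trans hj halpha)).
Qed.

Lemma step_exchange_top e f : distinct_active alpha (alpha j) e ->
  step_weight q t id alpha (alpha j) e f
  = step_weight q t s alpha (alpha j) e f
    + exchange_coef e * step_weight q t s alpha (alpha j) (swap e) f.
Proof.
move=> de; rewrite !step_weight_top_left // !step_weight_top_right //.
rewrite /exchange_coef !swap_i !swap_j [X in _ = _ + X]mulrACA.
rewrite environment_below //.
rewrite -!mulrDr; congr (_ * _).
apply: (top_exchange t_nz); first exact: ratio_neq1.
  by rewrite /swap_ratio -mulrA -exprSr; apply: generic.
have /forallP/(_ i)/forallP/(_ j) := de.
by rewrite (neq_ij hij) leqnn (ltnW halpha).
Qed.

(** Above the short column only the tall one of the two is present, so their
    relative order is irrelevant. *)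
Lemma step_weight_above h e f : (alpha j < h)%N ->
  step_weight q t id alpha h e f = step_weight q t s alpha h e f.
Proof.
move=> hj.
have posE k l : (alpha j < alpha k)%N -> (alpha j < alpha l)%N ->
    (s k < s l)%N = (k < l)%N.
  move=> hk hl; case ki: (k == i); last first.
    apply: (s_other hij); rewrite /other ki.
    by case: (k =P j) hk => // ->; rewrite ltnn.
  case li: (l == i); first by rewrite (eqP ki) (eqP li) !ltnn.
  apply: (s_other hij); rewrite /other li.
  by case: (l =P j) hl => [->|_ _]; rewrite ?ltnn ?orbT.
have posE' k l : (h < alpha k)%N -> (h <= alpha l)%N ->
    ((s l < s k)%N = (l < k)%N) * ((s k < s l)%N = (k < l)%N).
  by move=> hk hl; split; apply: posE;
    rewrite ?(ltn_trans hj hk) ?(leq_trans hj hl).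
have armE k l : (h < alpha k)%N -> in_arm id alpha h k l = in_arm s alpha h k l.
  move=> hk; rewrite /in_arm; have [hl|hl] := leqP h (alpha l).
    by rewrite /= !(posE' _ _ hk hl).
  by rewrite [(h < alpha l)%N]ltnNge (ltnW hl) !andbF.
rewrite /step_weight; congr (_ * _); apply: eq_bigr => k _.
  rewrite /box_weight /arm_size; case: ifP => // hk.
  by under eq_bigr => l _ do rewrite armE //.
apply: eq_bigr => l _; rewrite /pair_weight /compatible /step_coinv.
have [hk|//] := ltnP h (alpha k); rewrite /= armE //.
have [hl|hl] := leqP h (alpha l); first by rewrite /= !(posE' _ _ hk hl).
by rewrite /in_arm [(h < alpha l)%N]ltnNge (ltnW hl) [(h <= alpha l)%N]leqNgt hl
  !andbF.
Qed.

Section TransferExchange.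
Context (d : 'I_n).

Lemma step_weight_distinct pos h e f : ~~ distinct_active alpha h.+1 f ->
  step_weight q t pos alpha h e f = 0.
Proof.
rewrite negb_forall => /existsP[k]; rewrite negb_forall => /existsP[l].
rewrite negb_imply negbK => /andP[hkl fkl].
rewrite /step_weight [X in _ * X](bigD1 k) //= [X in _ * (X * _)](bigD1 l) //=.
by rewrite /pair_weight /compatible hkl fkl !(mul0r, mulr0).
Qed.

Lemma transfer_exchange_above m h e : (alpha j < h)%N ->
  transfer q t id alpha d m h e = transfer q t s alpha d m h e.
Proof.
elim: m h e => //= m IH h e hj; apply: eq_bigr => f _.
by rewrite step_weight_above // IH // ltnW.
Qed.

Lemma blank_above_swap h f : (h < alpha j)%N ->
  blank_above d alpha h (swap f) = blank_above d alpha h f.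
Proof.
move=> hj; apply: eq_forallb => k; rewrite ffunE.
by case: tpermP => // ->;
  rewrite ![(alpha _ <= h)%N]leqNgt ?hj ?(ltn_trans hj halpha).
Qed.

Lemma step_monomial_swap h f : (h < alpha j)%N ->
  step_monomial alpha h (swap f) = step_monomial alpha h f :> {mpoly F[n]}.
Proof.
move=> hj; rewrite /step_monomial [RHS](reindex_inj (@perm_inj _ s)) /=.
apply: eq_big => [k|k _]; last by rewrite ffunE.
by case: tpermP => // ->; rewrite ?hj ?(ltn_trans hj halpha).
Qed.

(** Descending induction on the row.  The bound on [m] makes the rows
    summed over reach above the short column, where the induction starts. *)
Theorem transfer_exchange m h e : (h <= alpha j)%N -> (alpha j < m + h)%N ->
  distinct_active alpha h e ->
  transfer q t id alpha d m h e
  = transfer q t s alpha d m h e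
    + exchange_coef e *: transfer q t s alpha d m h (swap e).
Proof.
elim: m h e => [|m IH] h e hj hm de; first by move: hm; rewrite add0n ltnNge hj.
rewrite /= scaler_sumr; have [hj'|hj'] := ltnP h (alpha j); last first.
  have eh : h = alpha j by apply/eqP; rewrite eqn_leq hj.
  rewrite -big_split /=; apply: eq_bigr => f _.
  rewrite transfer_exchange_above ?ltnS // eh step_exchange_top -?eh //.
  by rewrite scalerA -scalerDl.
have hm' : (alpha j < m + h.+1)%N by rewrite addnS -addSn.
(* Words with a repeated entry are attacked and have weight 0, so the induction
   hypothesis is only called for words with distinct active entries. *)
pose X f := step_monomial alpha h f * transfer q t s alpha d m h.+1 f.
transitivity (\sum_(f | blank_above d alpha h f)
   (step_weight q t id alpha h e f *: X f
    + (exchange_coef f * step_weight q t id alpha h e f) *: X (swap f))).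
  apply: eq_bigr => f _.
  have [df|/step_weight_distinct f0] := boolP (distinct_active alpha h.+1 f).
    rewrite IH // mulrDr scalerDr; congr (_ + _).
    by rewrite /X step_monomial_swap // -scalerAr scalerA mulrC.
  by rewrite f0 mulr0 !scale0r addr0.
rewrite big_split /=.
rewrite [X in _ + X = _](reindex_inj (inv_inj (@swap_wordK _ i j))) /=.
under [X in _ + X = _]eq_bigl => f do rewrite blank_above_swap //.
rewrite -!big_split /=; apply: eq_bigr => f _.
by rewrite swap_wordK scalerA -!scalerDl step_exchange.
Qed.
End TransferExchange.

End StepExchange.

(** * Fillings as sequences of rows *)

Section Paths.
Context {F : fieldType} (q t : F) {n : nat} (pos : 'I_n -> 'I_n)
  (alpha : composition n) (d : 'I_n).

Definition step_term h (e f : word n) : {mpoly F[n]} :=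
  if blank_above d alpha h f
  then step_weight q t pos alpha h e f *: step_monomial alpha h f else 0.

Lemma transfer_paths m h e :
  transfer q t pos alpha d m h e =
  \sum_(w : m.-tuple (word n))
     \prod_(r < m) step_term (h + r) (nth e (e :: w) r) (nth e w r).
Proof.
elim: m h e => [|m IH] h e /=.
  rewrite (big_pred1 [tuple]) ?big_ord0 // => w.
  by apply/esym/eqP/val_inj; case: w => -[].
transitivity (\sum_f \sum_(w : m.-tuple (word n)) step_term h e f
    * \prod_(r < m) step_term (h.+1 + r) (nth f (f :: w) r) (nth f w r)).
  rewrite big_mkcond; apply: eq_bigr => f _; rewrite -big_distrr /= -IH.
  by rewrite /step_term; case: ifP; rewrite ?mul0r // scalerAl.
rewrite pair_bigA /=.
pose cons_pair (p : word n * m.-tuple (word n)) := [tuple of p.1 :: p.2].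
rewrite (reindex cons_pair) /=; last first.
  exists (fun w => (thead w, [tuple of behead w])) => [[f w] _|w _] /=.
    by congr (_, _); apply/val_inj.
  by rewrite /cons_pair -tuple_eta.
apply: eq_bigr => -[f w] _; rewrite /cons_pair big_ord_recl /= addn0.
congr (_ * _).
apply: eq_bigr => r _; rewrite /= addSnnS.
congr step_term; last by apply: set_nth_default; rewrite size_tuple.
case: (r : nat) (ltn_ord r) => //= r' hr'.
by apply: set_nth_default; rewrite size_tuple ltnW.
Qed.
End Paths.

Local Notation col := Defs.col.
Local Notation row := Defs.row.

Section Boxes.
Context {n : nat} (alpha : composition n).

Lemma mkboxK (u : box alpha) : mkbox alpha (col u) (row u) = u.
Proof.
by case: u => k r; rewrite /mkbox /col /row /=; congr Tagged; apply: inord_val.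
Qed.

Lemma row_le (u : box alpha) : (row u <= alpha (col u))%N.
Proof. by rewrite -ltnS ltn_ord. Qed.

Lemma row_mkboxE k r :
  row (mkbox alpha k r) = if (r <= alpha k)%N then r else 0%N.
Proof. by rewrite /row /mkbox /= val_insubd ltnS. Qed.

Lemma big_dg (R : Type) (idx : R) (op : Monoid.com_law idx) N
    (G : box alpha -> R) :
  (forall k, alpha k <= N)%N ->
  \big[op/idx]_(u in dg alpha) G u =
  \big[op/idx]_(r < N) \big[op/idx]_(k | (r < alpha k)%N)
    G (mkbox alpha k r.+1).
Proof.
move=> hN; rewrite (exchange_big_dep xpredT) //=.
rewrite big_mkcond /=.
pose G' k (r : 'I_(alpha k).+1) := if (0 < r)%N then G (Tagged _ r) else idx.
rewrite (eq_bigr (fun u : box alpha => G' (tag u) (tagged u))); last first.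
  by case=> k r _; rewrite inE.
rewrite -(@sig_big_dep _ _ _ _ _ xpredT (fun _ => xpredT) G') /= /G'.
apply: eq_bigr => k _; rewrite big_ord_recl /= Monoid.mul1m.
rewrite -(big_ord_widen N (fun r => G (mkbox alpha k r.+1)) (hN k)).
apply: eq_bigr => r _; congr G; rewrite /mkbox; congr Tagged; apply/val_inj.
by rewrite /= inordK // ltnS.
Qed.

Lemma big_Arm (R : Type) (idx : R) (op : Monoid.com_law idx) k r
    (G : box alpha -> R) :
  (r < alpha k)%N ->
  \big[op/idx]_(v in Arm (mkbox alpha k r.+1)) G v =
  \big[op/idx]_(l | in_arm id alpha r k l)
    G (mkbox alpha l (if (l < k)%N then r else r.+1)).
Proof.
move=> hr.
rewrite (reindex_onto (fun l => mkbox alpha l (if (l < k)%N then r else r.+1))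
  (fun v => col v)) /=; last first.
  move=> v; rewrite /Arm !inE row_mkbox // => hv.
  rewrite -[RHS]mkboxK; congr mkbox.
  case/orP: hv => [/and3P[/eqP -> -> _]|/and4P[_ /eqP -> kv _]] //.
  by rewrite ltnNge (ltnW kv).
apply: eq_bigl => l; rewrite /Arm !inE !row_mkboxE hr /= eqxx andbT /in_arm /=.
case: ltngtP => lk /=; rewrite ?andbF ?orbF /=.
- have [hl|hl] := leqP r (alpha l); first by rewrite eqxx andbT.
  by rewrite andbF ltn_eqF // (leq_ltn_trans _ hl).
- by have [hl|hl] := ltnP r (alpha l); rewrite ?eqxx /= ?andbT ?andbF.
- by [].
Qed.
End Boxes.

Definition word_of n (sigma : 'S_n) : word n := [ffun k => sigma k].

Section Fillings.
Context {n : nat} (alpha : composition n) (sigma : 'S_n) (d : 'I_n) (N : nat).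
Context (hN : forall k, (alpha k <= N)%N).
Implicit Types (T : filling alpha) (w : N.-tuple (word n)).

Definition row_word T r : word n :=
  [ffun k => if (r <= alpha k)%N then T (mkbox alpha k r) else d].

Definition rows_of T : N.-tuple (word n) := [tuple row_word T r.+1 | r < N].

Definition level w r : word n := nth (word_of sigma) (word_of sigma :: w) r.

Definition fill w : filling alpha := [ffun u => level w (row u) (col u)].

Definition good_rows w : bool :=
  [forall r : 'I_N, blank_above d alpha r (level w r.+1)
     && [forall k, forall l,
           compatible id alpha r (level w r) (level w r.+1) k l]].

Lemma level_rows T r : (r <= N)%N -> has_basement sigma T ->
  level (rows_of T) r = row_word T r.
Proof.
move=> hr /forallP bT; case: r hr => [_|r hr].
  by apply/ffunP => k; rewrite !ffunE (eqP (bT k)).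
rewrite -[LHS]/(nth _ (rows_of T) (Ordinal hr)).
by rewrite -tnth_nth tnth_mktuple.
Qed.

Lemma fill_basement w : has_basement sigma (fill w).
Proof. by apply/forallP => k; rewrite ffunE row_mkbox //= ffunE. Qed.

Lemma rows_ofK T : has_basement sigma T -> fill (rows_of T) = T.
Proof.
move=> bT; apply/ffunP => u; rewrite ffunE level_rows //.
  by rewrite ffunE row_le mkboxK.
exact: leq_trans (row_le u) (hN _).
Qed.

Lemma fillK w : good_rows w -> rows_of (fill w) = w.
Proof.
move=> /forallP gw; apply: eq_from_tnth => r; rewrite tnth_mktuple.
have /andP[/forallP bl _] := gw r.
apply/ffunP => k; rewrite ffunE (tnth_nth (word_of sigma)); case: ltnP => hk.
  by rewrite ffunE row_mkbox.
by have /implyP/(_ hk)/eqP <- := bl k.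
Qed.

(** [rows_of] and [fill] restrict to inverse bijections between non-attacking
    fillings and admissible sequences of rows. *)
Lemma good_rows_NAF T :
  good_rows (rows_of T) && (fill (rows_of T) == T) = (T \in NAF alpha sigma).
Proof.
rewrite inE; case bT: (has_basement sigma T); last first.
  apply/negbTE/andP => -[_ /eqP TE].
  by move: bT; rewrite -TE fill_basement.
rewrite rows_ofK // eqxx andbT /=.
have lvl (r : 'I_N) : (level (rows_of T) r = row_word T r)
    * (level (rows_of T) r.+1 = row_word T r.+1).
  by split; apply: level_rows => //; apply: ltnW.
apply/forallP/forallP => [H u|H r].
  apply/forallP => v; apply/implyP => /orP[]/andP[/eqP ruv cuv].
    case ru: (row u) => [|r].
      (* Two basement boxes: their entries differ as sigma is injective. *)
      rewrite -[u]mkboxK -[v]mkboxK -ruv ru.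
      have /forallP bT' := bT; rewrite !(eqP (bT' _)) (inj_eq perm_inj).
      by rewrite -val_eqE /= ltn_eqF.
    have hr : (r < N)%N.
      by rewrite -ru; apply: leq_trans (row_le u) (hN _).
    have /andP[_ /forallP/(_ (col u))/forallP/(_ (col v))/andP[+ _]] :=
      H (Ordinal hr).
    have hu : (r < alpha (col u))%N by rewrite -ru row_le.
    have hv : (r < alpha (col v))%N by rewrite -ru ruv row_le.
    rewrite (lvl (Ordinal hr)).2 !ffunE /= hu hv -val_eqE /= ltn_eqF //=.
    by rewrite -{1}ru -ru {2}ruv !mkboxK.
  have hu : (row v < alpha (col u))%N by rewrite -ruv row_le.
  have hr : (row v < N)%N by apply: leq_trans hu (hN _).
  have /andP[_ /forallP/(_ (col u))/forallP/(_ (col v))/andP[_]] :=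
    H (Ordinal hr).
  rewrite (lvl (Ordinal hr)).1 (lvl (Ordinal hr)).2 !ffunE /= hu row_le cuv /=.
  by rewrite -ruv !mkboxK.
rewrite !lvl; apply/andP; split.
  by apply/forallP => k; apply/implyP => hk; rewrite ffunE ltnNge hk.
have na u v : attacks u v -> T u != T v.
  by move=> uv; have /forallP/(_ v)/implyP := H u; apply.
apply/forallP => k; apply/forallP => l; rewrite /compatible !ffunE.
apply/andP; split.
  apply/implyP => /and3P[hk hl kl]; rewrite hk hl.
  have [kl'|kl'|/val_inj kl'] := ltngtP k l; last by rewrite kl' eqxx in kl.
    by apply: na; rewrite /attacks !row_mkbox // eqxx kl'.
  by rewrite eq_sym; apply: na; rewrite /attacks !row_mkbox // eqxx kl'.
apply/implyP => /and3P[hk hl lk]; rewrite hk hl.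
by apply: na; rewrite /attacks !row_mkbox // eqxx lk orbT.
Qed.

End Fillings.

Section FillingSum.
Context {F : fieldType} (q t : F) {n : nat} (alpha : composition n).

(** The weight of a filling, gathered box by box, over an arbitrary field. *)
Definition box_product (T : filling alpha) : F :=
  \prod_(u in dg alpha)
    (move_weight t (q ^+ (1 + leg u) * t ^+ (1 + arm u)) (q ^+ (leg u + 1))
       (T (down u)) (T u)
     * \prod_(v in Arm u) t ^+ coinv_triple (T u) (T v) (T (down u))).

Lemma leg_mkbox k r : (r < alpha k)%N ->
  leg (mkbox alpha k r.+1) = (alpha k - r.+1)%N.
Proof. by move=> hr; rewrite /leg row_mkbox. Qed.

Lemma down_mkbox k r : (r < alpha k)%N ->
  down (mkbox alpha k r.+1) = mkbox alpha k r.
Proof. by move=> hr; rewrite /down row_mkbox. Qed.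

Lemma arm_mkbox k r : (r < alpha k)%N ->
  arm (mkbox alpha k r.+1) = arm_size id alpha r k.
Proof.
by move=> hr; rewrite /arm -sum1_card big_Arm // /arm_size big_mkcond.
Qed.

Lemma step_weight_compatible (e f : word n) r :
  [forall k, forall l, compatible id alpha r e f k l] ->
  step_weight q t id alpha r e f =
  \prod_(k | (r < alpha k)%N)
    (move_weight t (q ^+ (alpha k - r) * t ^+ (arm_size id alpha r k).+1)
       (q ^+ (alpha k - r)) (e k) (f k)
     * \prod_(l | in_arm id alpha r k l)
         t ^+ coinv_triple (f k) (if (l < k)%N then e l else f l) (e k)).
Proof.
move=> /forallP ce; rewrite /step_weight [RHS]big_split /=; congr (_ * _).
  by rewrite [RHS]big_mkcond.
rewrite [RHS]big_mkcond; apply: eq_bigr => k _.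
have -> : \prod_l pair_weight t id alpha r e f k l
    = \prod_l t ^+ step_coinv id alpha r e f k l.
  apply: eq_bigr => l _; have /forallP/(_ l) := ce k.
  by rewrite /pair_weight => ->; rewrite mul1r.
rewrite /step_coinv; case: (r < alpha k)%N; last by rewrite big1.
by rewrite [RHS]big_mkcond; apply: eq_bigr => l _; case: (in_arm _ _ _ _ _).
Qed.

Lemma box_product_rows (sigma : 'S_n) d N T : (forall k, alpha k <= N)%N ->
  T \in NAF alpha sigma ->
  \prod_(r < N) step_term q t id alpha d r
     (level sigma (rows_of d N T) r) (level sigma (rows_of d N T) r.+1)
  = box_product T *: \prod_(u in dg alpha) 'X_(T u).
Proof.
move=> hN nT; have := nT.
rewrite -(good_rows_NAF sigma d hN) => /andP[/forallP gT _].
have bT : has_basement sigma T by move: nT; rewrite inE => /andP[].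
rewrite /box_product !(big_dg _ _ hN) -scaler_prod.
apply: eq_bigr => r _; have /andP[bl cT] := gT r.
rewrite /step_term bl step_weight_compatible //.
have lr := level_rows d (ltnW (ltn_ord r)) bT.
have lr1 := level_rows d (ltn_ord r) bT.
rewrite lr lr1; congr (_ *: _).
  apply: eq_bigr => k hk.
  rewrite leg_mkbox // down_mkbox // arm_mkbox // big_Arm //.
  rewrite !ffunE hk (ltnW hk) add1n addn1 -subSn // subSS; congr (_ * _).
  apply: eq_bigr => l; rewrite /in_arm !ffunE /=.
  by case: ltngtP => //= lk; rewrite ?orbF => /andP[_ ->].
by apply: eq_bigr => k hk; rewrite ffunE hk.
Qed.

Lemma transfer_fillings (sigma : 'S_n) d N : (forall k, alpha k <= N)%N ->
  transfer q t id alpha d N 0 (word_of sigma) =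
  \sum_(T in NAF alpha sigma) box_product T *: \prod_(u in dg alpha) 'X_(T u).
Proof.
move=> hN; rewrite transfer_paths (bigID (@good_rows n alpha sigma d N)) /=.
rewrite [X in _ + X]big1 ?addr0; last first.
  move=> w; rewrite negb_forall => /existsP[r]; rewrite negb_and => bad.
  rewrite (bigD1 r) //= /step_term add0n.
  rewrite -[nth _ w r]/(level sigma w r.+1).
  rewrite -[nth _ (_ :: _) r]/(level sigma w r).
  case/orP: bad => [/negbTE->|]; first by rewrite mul0r.
  rewrite negb_forall => /existsP[k].
  rewrite negb_forall => /existsP[l /negbTE bad].
  rewrite /step_weight [X in _ * X *: _](bigD1 k) //=.
  rewrite [X in _ * (X * _) *: _](bigD1 l) //=.
  by rewrite /pair_weight bad !(mul0r, mulr0) scale0r if_same mul0r.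
rewrite (reindex_onto (@rows_of n alpha d N) (@fill n alpha sigma N)) /=;
  last by move=> w; apply: fillK.
apply: eq_big => T; first exact: good_rows_NAF.
rewrite good_rows_NAF // => nT; rewrite -(box_product_rows d hN nT).
by apply: eq_bigr.
Qed.
End FillingSum.

Lemma weight_boxes {n} {alpha : composition n} (T : filling alpha) :
  weight T = box_product Defs.q Defs.t T.
Proof.
rewrite /box_product; set q := Defs.q; set t := Defs.t.
have qE : q ^+ maj T
    = \prod_(u in dg alpha) (q ^+ (leg u + 1)) ^+ chi (T u) (T (down u)).
  under eq_bigr do rewrite -exprM.
  rewrite prodrXr /maj /Des; congr (_ ^+ _).
  rewrite big_mkcond [RHS]big_mkcond; apply: eq_bigr => u _; rewrite !inE /chi.
  by case: (0 < row u)%N => //; case: ltnP; rewrite ?muln1 ?muln0.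
have tE : t ^+ coinv T = \prod_(u in dg alpha) \prod_(v in Arm u)
    t ^+ coinv_triple (T u) (T v) (T (down u)).
  under eq_bigr do rewrite prodrXr.
  rewrite prodrXr /coinv -sum1_card; congr (_ ^+ _).
  rewrite pair_big_dep /= big_mkcond [RHS]big_mkcond.
  apply: eq_bigr => -[u v] _ /=; rewrite inE [(u, v) \in triples _]inE /=.
  rewrite /coinv_triple.
  by case: (u \in dg _); case: (v \in Arm _); case: (_ == _).
rewrite /weight -/q -/t qE tE big_mkcondr /= -!big_split /=.
apply: eq_bigr => u _; rewrite /move_weight mulrAC; congr (_ * _).
case: eqP => [->|_] /=; last by rewrite mulrC.
by rewrite /chi ltnn expr0 mul1r.
Qed.

Lemma macdonald_transfer {n} (alpha : composition n) (sigma : 'S_n) d N :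
  (forall k, alpha k <= N)%N ->
  macdonald alpha sigma = transfer Defs.q Defs.t id alpha d N 0 (word_of sigma).
Proof.
move=> hN; rewrite (transfer_fillings _ _ _ _ hN).
by apply: eq_bigr => T _; rewrite weight_boxes.
Qed.

(** * The coefficient *)

Section Coefficient.
Context {n : nat} (i j : 'I_n) (alpha : composition n).
Context (hij : j = i.+1 :> nat).
Context (halpha : (alpha j < alpha i)%N).
Implicit Types (e f : word n) (k l : 'I_n).
Local Notation s := (tperm i j).
Local Notation other := (other i j).

(** twinv for columns placed by [pos]; for [pos = s] and the swapped word it is
    twinv of the swapped composition, with columns renamed. *)
Definition word_twinv (pos : 'I_n -> 'I_n) e : int :=
  \sum_k \sum_l [&& pos k < pos l, alpha l <= alpha k & e k < e l]%N%:Z.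

Lemma twinvE (beta : composition n) (sigma : 'S_n) :
  (twinv beta sigma)%:Z =
  \sum_(k < n) \sum_(l < n)
    [&& k < l, beta l <= beta k & sigma k < sigma l]%N%:Z.
Proof.
rewrite /twinv -sum1_card (big_morph Posz PoszD (erefl _)).
rewrite pair_bigA big_mkcond /=.
by apply: eq_bigr => -[k l] _; rewrite inE /=; case: (_ && _).
Qed.

Lemma twinv_drift e :
  word_twinv s (swap_word i j e) - word_twinv id e =
  total_drift i j alpha e - (e i < e j)%N%:Z.
Proof.
have ij := neq_ij hij.
rewrite /word_twinv !(big2_outside_pair _ ij) /= !ltnn /=.
have [s_ij s_ji] := s_i_j hij.
have lt_ij : (i < j)%N by rewrite hij.
have lt_ji : (j < i)%N = false by rewrite hij ltnNge leqnSn.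
rewrite s_ij s_ji lt_ij lt_ji [(alpha i <= alpha j)%N]leqNgt halpha.
rewrite (ltnW halpha) /=.
rewrite !add0r addr0.
have -> : \sum_(k | (k != i) && (k != j)) \sum_(l | (l != i) && (l != j))
    [&& s k < s l, alpha l <= alpha k
      & swap_word i j e k < swap_word i j e l]%N%:Z
  = \sum_(k | (k != i) && (k != j)) \sum_(l | (l != i) && (l != j))
    [&& k < l, alpha l <= alpha k & e k < e l]%N%:Z.
  apply: eq_bigr => k ok; apply: eq_bigr => l ol.
  by rewrite (s_other hij) ?swap_other // /other ok.
set B := \sum_(k | _) \sum_(l | _) _.
set X := \sum_(l | _) _; set Y := \sum_(l | _) _.
suff -> : total_drift i j alpha e = X - Y by ring.
rewrite /total_drift /X /Y -sumrB; apply: eq_bigr => l ol.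
rewrite !(s_other hij) ?ol ?orbT // !swap_i !swap_j !(swap_other _ ol).
rewrite /drift /chi.
have /orP := other_side hij ol.
have Hl : (alpha i <= alpha l)%N ==> (alpha j <= alpha l)%N by lia.
have Hr : (alpha l <= alpha j)%N ==> (alpha l <= alpha i)%N by lia.
case=> /andP[/andP[/andP[-> ->] /negbTE->] /negbTE->] /=.
  rewrite [(alpha l < alpha i)%N]ltnNge; move: Hl.
  case: (alpha i <= alpha l)%N; case: (alpha j <= alpha l)%N => //= _; ring.
rewrite [(alpha j < alpha l)%N]ltnNge; move: Hr.
case: (alpha l <= alpha j)%N; case: (alpha l <= alpha i)%N => //= _; ring.
Qed.

Lemma twinv_swap (sigma : 'S_n) :
  (twinv (swap_parts i j alpha) sigma)%:Z - (twinv alpha sigma)%:Z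
  = total_drift i j alpha (word_of sigma) - (sigma i < sigma j)%N%:Z.
Proof.
have -> : (sigma i < sigma j)%N = (word_of sigma i < word_of sigma j)%N.
  by rewrite !ffunE.
rewrite !twinvE -twinv_drift; congr (_ - _); rewrite /word_twinv.
  rewrite (reindex_tperm i j); apply: eq_bigr => k _.
  rewrite (reindex_tperm i j); apply: eq_bigr => l _.
  by rewrite !ffunE !tpermK.
by apply: eq_bigr => k _; apply: eq_bigr => l _; rewrite !ffunE.
Qed.

Lemma swap_ratioE :
  let u := mkbox (swap_parts i j alpha) j (alpha j).+1 in
  Defs.q ^+ (leg u + 1) * Defs.t ^+ arm u = swap_ratio Defs.q Defs.t i j alpha.
Proof.
have hb : (alpha j < swap_parts i j alpha j)%N by rewrite ffunE tpermR.
rewrite /= leg_mkbox // arm_mkbox // addn1 -subSn // subSS ffunE tpermR.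
rewrite /swap_ratio; congr (_ * _ ^+ _).
have -> : arm_size id (swap_parts i j alpha) (alpha j) j
    = arm_size s alpha (alpha j) i.
  rewrite /arm_size (reindex_tperm i j); apply: eq_bigr => l _.
  by rewrite /in_arm !ffunE !tpermK tpermL tpermR.
rewrite (arm_size_tall alpha hij); last by right.
by rewrite /in_arm (s_i_j hij).1 (s_i_j hij).2 halpha leqnn.
Qed.
End Coefficient.

Lemma t_neq0 : Defs.t != 0.
Proof.
rewrite tofrac_eq0; apply/eqP => /(congr1 (meval (fun=> 1))).
by rewrite mevalXU meval0 => /eqP; rewrite oner_eq0.
Qed.

(** The denominators do not vanish, because 1 - q^a t^(b + 1) takes the value 1
    at q = t = 0. *)
Lemma qt_generic a b : 1 - Defs.q ^+ a * Defs.t ^+ b.+1 != 0.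
Proof.
rewrite subr_eq0 -!tofracXn -tofracM -tofrac1 tofrac_eq.
apply/eqP => /(congr1 (meval (fun=> 0))).
rewrite rmorph1 rmorphM !rmorphXn /= !mevalXU [0 ^+ b.+1]exprS mul0r mulr0.
by move/eqP; rewrite oner_eq0.
Qed.

Lemma swap_coefE n (sigma : 'S_n) (alpha : composition n) (i j : 'I_n) :
  j = i.+1 :> nat -> (alpha j < alpha i)%N ->
  swap_coef i j alpha sigma
  = exchange_coef Defs.q Defs.t i j alpha (word_of sigma).
Proof.
move=> hij halpha; rewrite /swap_coef swap_ratioE // twinv_swap //.
rewrite /exchange_coef /swap_factor !ffunE.
move: (swap_ratio _ _ _ _ _) (total_drift _ _ _ _) t_neq0 => z D.
move: Defs.t => t t_nz.
have := neq_ij hij; rewrite -(inj_eq (@perm_inj _ sigma)) -val_eqE /=.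
case: ltngtP => // _ _.
  by rewrite expfzDr // -!mulrA; congr (_ * _); rewrite mulrCA; congr (_ * _);
     rewrite mulrCA; congr (_ * _); rewrite mulrC.
by rewrite subr0 mulr1 mulr1.
Qed.

(** * The theorem *)

Theorem theorem1p3 (n : nat) (hn : (1 <= n)%N) (sigma : 'S_n)
    (alpha : composition n) (i j : 'I_n) (hij : j = i.+1 :> nat)
    (halpha : (alpha j < alpha i)%N) :
  macdonald alpha sigma =
    macdonald (swap_parts i j alpha) (swap_positions i j sigma)
    + swap_coef i j alpha sigma *: macdonald (swap_parts i j alpha) sigma.
Proof.
pose N := (\max_k alpha k)%N.
have hN k : (alpha k <= N)%N by apply: leq_bigmax.
have hsN k : (swap_parts i j alpha k <= N)%N by rewrite ffunE.
rewrite (macdonald_transfer sigma i hN) !(macdonald_transfer _ i hsN).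
rewrite !transfer_relabel swap_coefE //.
have -> : swap_word i j (word_of (swap_positions i j sigma)) = word_of sigma.
  by apply/ffunP => k; rewrite !ffunE permM tpermK.
apply: transfer_exchange => //; first exact: t_neq0.
- exact: qt_generic.
- by rewrite addn0 (leq_trans halpha).
apply/forallP => k; apply/forallP => l; apply/implyP => /and3P[_ _ kl].
by rewrite !ffunE (inj_eq perm_inj).
Qed.
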